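(* For all integers $n\geq 0$, $m\geq 3$, every digraph $D$ on the $m$ vertices $\mathcal{M}=\{1,\ldots,m\}$, and every $k\in\mathcal{N}=\{1,\ldots,n\}$, $$t_k^{n,m}(D)=|A(D)|\,m^{n-k}(m-2)^{k-1},$$ where $t_k^{n,m}(D)$ is the number of arcs of the restricted Hanoi graph $H_n^m(D)$ that correspond to moves of disc $k$.
   Context: Let $\mathcal{N}=\{1,\ldots,n\}$ be the set of discs (disc $d$ is smaller than disc $d'$ when $d<d'$) and $\mathcal{M}=\{1,\ldots,m\}$ the set of pegs. A movement digraph is a digraph $D=(\mathcal{M},A(D))$ (no loops, no multiple arcs), where $(p,q)\in A(D)$ means that moving a disc from peg $p$ to peg $q$ is allowed. The restricted Hanoi graph $H_n^m(D)$ is the digraph whose vertices are all the distributions of the $n$ discs on the $m$ pegs, each written as an $n$-tuple $u=u_n\ldots u_1$ with $u_d\in\mathcal{M}$ the peg on which disc $d$ lies (on each peg the discs are stacked with smaller discs above larger ones). There is an arc $(u,v)\in A(H_n^m(D))$ if and only if $v$ is obtained from $u$ by one legal move, i.e. a move obeying: (i) exactly one disc is moved, from its peg to a different one; (ii) the disc moved is the topmost disc of its peg; (iii) a disc cannot be placed on a smaller one; and the disc is moved from a peg $p$ to a peg $q$ with $(p,q)\in A(D)$. An arc $(u,v)$ corresponds to a move of disc $k$ if $u_k\neq v_k$. *)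

(* Defs.v *)
From mathcomp Require Import all_boot.

Set Implicit Arguments.
Unset Strict Implicit.
Unset Printing Implicit Defensive.

(* A digraph on a finite vertex type V is its adjacency relation, hence has no
   multiple arcs; the absence of loops is stated separately as [irreflexive].  *)
Definition arcs (V : finType) (E : rel V) : {set V * V} :=
  [set a | E a.1 a.2].

(* Indices start at 0: the ordinal d stands for disc d + 1 and the ordinal p for
   peg p + 1.  Smaller ordinals are smaller discs.  Since the order of the discs
   on each peg is forced, a distribution is just the map sending each disc to
   its peg.                                                                    *)
Definition state (n m : nat) := {ffun 'I_n -> 'I_m}.

Section Hanoi.

Variables (n m : nat) (D : rel 'I_m).
Implicit Types (u v : state n m) (d e : 'I_n) (q : 'I_m).

Definition topmost u d : bool := [forall e, (u e == u d) ==> (d <= e)].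

(* The disc that d would be placed on is the topmost disc of q, if any. *)
Definition can_place u d q : bool :=
  [forall e, (u e == q) && topmost u e ==> ~~ (e < d)].

Definition move u d q : state n m := [ffun e => if e == d then q else u e].

Definition legal_move u d q : bool :=
  [&& q != u d, topmost u d, can_place u d q & D (u d) q].

Definition hanoi : rel (state n m) :=
  fun u v => [exists d, exists q, legal_move u d q && (v == move u d q)].

Definition disc_moves (k : 'I_n) : nat :=
  #|[set a in arcs hanoi | a.1 k != a.2 k]|.

End Hanoi.

(* Main.v *)
Require Import Defs.
From mathcomp Require Import all_boot.

(** A legal move of disc [k] from peg [p] to peg [q] exists exactly when [k]
    lies on [p], the arc [(p, q)] belongs to [D], and no smaller disc lies on
    [p] (otherwise [k] is not topmost) or on [q] (otherwise [k] would be placed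
    on a smaller disc).  Larger discs are unconstrained, and the target state is
    determined by the source and [q].  This is [hanoi_movesE]; it reduces the
    count to states: for each arc [(p, q)] of [D], each of the [k] smaller discs
    (counting from 0) has [m - 2] pegs available because [p != q], disc [k] has
    one, and each of the [n - k.+1] larger discs has [m]. *)

Section Moves.

Variables (n m : nat) (D : rel 'I_m).
Implicit Types (u v : state n m) (k d e : 'I_n) (p q : 'I_m).

(** A peg carrying a disc smaller than [d] has a topmost disc smaller than [d],
    namely its smallest one, so comparing [d] with topmost discs only amounts to
    comparing it with all the discs of the peg. *)
Lemma can_placeP u d q :
  reflect (forall e, u e = q -> d <= e) (can_place u d q).
Proof.
apply: (iffP forallP) => [place e ue | above e]; last first.
  by apply/implyP => /andP[/eqP ue _]; rewrite -leqNgt above.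
have ueq : u e == q by apply/eqP.
have [e0 /eqP ue0 min_e0] := @arg_minnP _ e (fun e => u e == q) val ueq.
have top_e0 : topmost u e0.
  by apply/forallP => e1; apply/implyP; rewrite ue0; apply: min_e0.
have := place e0; rewrite ue0 eqxx top_e0 /= -leqNgt => /leq_trans; apply.
exact: min_e0.
Qed.

(** The pegs on which each disc may lie in a state where disc [k] can be moved
    from [p] to [q]. *)
Definition movable_from k p q e : pred 'I_m :=
  if e < k then [predC pred2 p q] else if e == k then pred1 p else predT.

Lemma legal_moveE k q u : q != u k ->
  legal_move D u k q = D (u k) q && (u \in family (movable_from k (u k) q)).
Proof.
move=> neq; rewrite /legal_move neq /= andbA andbC; congr (_ && _).
apply/andP/familyP => [[/forallP top /can_placeP place] e | fam].
  rewrite /movable_from; case: ltnP => [lt_ek | _].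
    rewrite !inE; apply/norP; split; apply/negP => /eqP ue.
      by have := top e; rewrite ue eqxx /= leqNgt lt_ek.
    by have := place e ue; rewrite leqNgt lt_ek.
  by case: eqP => [->|_]; rewrite ?inE.
split.
  apply/forallP => e; apply/implyP => /eqP ue; rewrite leqNgt; apply/negP => lt.
  by have := fam e; rewrite /movable_from lt !inE ue eqxx.
apply/can_placeP => e ue; rewrite leqNgt; apply/negP => lt.
by have := fam e; rewrite /movable_from lt !inE ue eqxx orbT.
Qed.

(** Only the moved disc changes its peg, so an arc on which [k] changes peg is a
    move of [k] to the peg on which [k] ends. *)
Lemma hanoi_movesE k u v : u k != v k ->
  hanoi D u v = [&& D (u k) (v k), u \in family (movable_from k (u k) (v k))
                  & v == move u k (v k)].
Proof.
move=> neq; rewrite andbA -legal_moveE; last by rewrite eq_sym.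
apply/existsP/andP => [[d /existsP[q /andP[legal /eqP def_v]]] | [legal def_v]].
  have dk : d = k.
    by apply/eqP; apply: contraNT neq; rewrite def_v ffunE eq_sym => /negPf->.
  have vk : v k = q by rewrite def_v ffunE dk eqxx.
  by rewrite vk -dk legal {1}def_v.
by exists k; apply/existsP; exists (v k); rewrite legal.
Qed.

Lemma card_movable_from k p q : p != q ->
  #|family (movable_from k p q)| = m ^ (n - k.+1) * (m - 2) ^ k.
Proof.
move=> neq; rewrite card_family foldrE big_map big_enum /=.
pose G i := if i < k then m - 2 else if i == k then 1 else m.
have cardG (e : 'I_n) : #|movable_from k p q e| = G e.
  rewrite /movable_from /G; case: ifP => _.
    have /(congr1 (subn^~ 2)) := cardC (pred2 p q).
    by rewrite card2 neq addKn card_ord => <-; apply: eq_card.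
  by rewrite -val_eqE; case: ifP => _; rewrite ?card1 ?card_ord.
rewrite (eq_bigr (fun e : 'I_n => G e)) // -(big_mkord xpredT G).
rewrite (big_cat_nat (n := k)) //=; last exact: ltnW.
rewrite (big_ltn (m := k)) // {2}/G ltnn eqxx mul1n mulnC; congr (_ * _).
  rewrite (eq_big_nat _ _ (F2 := fun=> m)) ?prod_nat_const_nat // => i /andP[lt _].
  by rewrite /G ltnNge (ltnW lt) /= gtn_eqF.
rewrite (eq_big_nat _ _ (F2 := fun=> m - 2)) ?prod_nat_const_nat ?subn0 //.
by move=> i /andP[_ lt]; rewrite /G lt.
Qed.

End Moves.

Arguments hanoi_movesE {n m D k u v}.
Arguments card_movable_from {n m} k {p q}.
Arguments movable_from {n m}.

Theorem proposition5 (n m : nat) (hm : 3 <= m)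
    (D : rel 'I_m) (hD : irreflexive D) (k : 'I_n) :
  disc_moves D k = #|arcs D| * m ^ (n - k.+1) * (m - 2) ^ (k.+1 - 1).
Proof.
rewrite subn1 /= -mulnA /disc_moves -sum1_card -sum_nat_const.
pose pegs_of_k (a : state n m * state n m) := (a.1 k, a.2 k).
rewrite (partition_big pegs_of_k (mem (arcs D))) /=; last first.
  move=> [u v]; rewrite !inE /= => /andP[arc neq].
  by move: arc; rewrite (hanoi_movesE neq) => /andP[].
apply: eq_bigr => -[p q]; rewrite inE /= => Dpq.
have neq : p != q by apply: contraTneq Dpq => ->; rewrite hD.
rewrite -(card_movable_from k neq) sum1_card.
(* An arc is recovered from its source, its target being [move u k q]. *)
rewrite -(card_imset (family (movable_from k p q))
            (f := fun u : state n m => (u, move u k q))); last by move=> u v [].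
apply: eq_card => -[u v]; rewrite [LHS]unfold_in /= !inE /=.
apply/andP/imsetP => [[/andP[arc ukvk] /eqP[uk vk]] | [w fam [-> ->]]].
  move: arc; rewrite (hanoi_movesE ukvk) uk vk => /and3P[_ fam /eqP->].
  by exists u.
have wk : w k = p.
  by have /familyP/(_ k) := fam; rewrite /movable_from ltnn eqxx inE => /eqP.
have mk : move w k q k = q by rewrite ffunE eqxx.
have neq' : w k != move w k q k by rewrite wk mk.
by rewrite (hanoi_movesE neq') /pegs_of_k /= wk mk neq Dpq fam !eqxx.
Qed.
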